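(* Let $D_1,D_2$ be distortion functions with corresponding probability measures $Q_1,Q_2$ on $\mathcal{B}((0,1))$. Assume that there exists some $\delta\in(0,1)$ such that $D_1(u)\le D_2(u)$ holds for every $u\in[\delta,1)$. Then $\mathcal{L}_{Q_1}\subseteq\mathcal{L}_{Q_2}$.
   Context: ''Increasing'' is meant in the weak sense. $(\Omega,\mathcal{F},P)$ is a fixed probability space and $\mathcal{L}^0$ is the set of all real random variables on it. For $X\in\mathcal{L}^0$, $F_X(x):=P[\{X\le x\}]$ and $F_X^\leftarrow:(0,1)\to\mathbb{R}$, $F_X^\leftarrow(u):=\inf\{x\in\mathbb{R}\mid F_X(x)\ge u\}$, is the (lower) quantile function. A distortion function is an increasing, right-continuous function $D:[0,1]\to[0,1]$ with $D(0)=0$ and $\sup_{u\in(0,1)}D(u)=1$ (hence $D(1)=1$). The probability measure $Q$ on $\mathcal{B}((0,1))$ corresponding to $D$ is the unique one with $Q[(0,u]]=D(u)$ for all $u\in(0,1)$. For such $Q$, $\mathcal{L}_Q:=\{X\in\mathcal{L}^0\mid\int_{(0,1)}(F_X^\leftarrow(u))^+\,dQ(u)<\infty\}$. *)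

(* Defs.v *)
From HB Require Import structures.
From mathcomp Require Import all_boot all_order all_algebra.
From mathcomp Require Import all_classical all_reals all_analysis.

Set Implicit Arguments.
Unset Strict Implicit.
Unset Printing Implicit Defensive.

Import Order.TTheory GRing.Theory Num.Theory.
Import numFieldNormedType.Exports.

Local Open Scope classical_set_scope.
Local Open Scope ring_scope.

Section unit_interval.
Variable R : realType.

Definition unit_itv : Type := {u : R | u \in `]0, 1[}.

HB.instance Definition _ := SubChoice.on unit_itv.

Lemma half_in_unit_itv : (2^-1 : R) \in `]0, 1[.
Proof. by rewrite in_itv /= invr_gt0 ltr0n /= invf_lt1 ?ltr1n ?ltr0n. Qed.

HB.instance Definition _ :=
  isPointed.Build unit_itv (exist _ 2^-1 half_in_unit_itv).

Definition unit_itv_val (u : unit_itv) : R := val u.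

End unit_interval.

(* The Borel sets of (0,1) are the traces on (0,1) of the Borel sets of R,
   i.e. the preimages of the latter under the inclusion. *)
Notation borel_unit_itv R :=
  (g_sigma_algebra_preimageType (@unit_itv_val R)).

(* D is a function on [0,1]; its values outside of [0,1] are irrelevant.
   Right-continuity is a condition at the points of [0,1) only. *)
Record is_distortion (R : realType) (D : R -> R) : Prop := IsDistortion {
  distortion_range : forall u, u \in `[0, 1] -> D u \in `[0, 1];
  distortion_increasing : {in `[0, 1] &, {homo D : u v / u <= v}};
  distortion_right_continuous :
    forall u, u \in `[0, 1[ -> D x @[x --> u^'+] --> D u;
  distortion0 : D 0 = 0;
  distortion_sup : sup (D @` [set` `]0, 1[]) = 1
}.

Definition corresponds_to (R : realType)
    (Q : probability (borel_unit_itv R) R) (D : R -> R) : Prop :=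
  forall u : R, u \in `]0, 1[ ->
    Q [set v : borel_unit_itv R | unit_itv_val v <= u] = (D u)%:E.

Section quantile.
Context d (T : measurableType d) (R : realType) (P : probability T R).

Definition quantile (X : {RV P >-> R}) (u : R) : R :=
  inf [set x : R | (u%:E <= cdf X x)%E].

Definition L_ (Q : probability (borel_unit_itv R) R) : set {RV P >-> R} :=
  [set X | (\int[Q]_u (Num.max (quantile X (unit_itv_val u)) 0)%:E < +oo)%E].

End quantile.
Arguments L_ {d T R} P Q.

(* Main.v *)
(** A distortion function dominated by another one near 1 gives a heavier upper
    tail: [Q2 {g > t} <= Q1 {g > t}] for every increasing [g >= 0] that vanishes
    at [delta], because [{g <= t}] is then a down-set containing [delta], hence
    an increasing union of rays [(0, s]] with [delta <= s < 1].  By the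
    layer-cake formula the integral of [g] under [Q2] is at most its integral
    under [Q1].  With [f] the positive part of the quantile function, apply this
    to [g = (f - f delta)^+], which satisfies [g <= f <= g + f delta]. *)

From HB Require Import structures.
Require Import Defs.
From mathcomp Require Import all_boot all_order all_algebra.
From mathcomp Require Import all_classical all_reals all_analysis.
From mathcomp Require Import measurable_realfun.

Import Order.TTheory GRing.Theory Num.Theory.
Local Open Scope classical_set_scope.
Local Open Scope ring_scope.

(** Each side is the integral over [[0, +oo[] of the complementary cdf of [X], and these tails
    compare pointwise. *)
Lemma ge0_le_integral_tail (d : measure_display) (T : measurableType d)
    (R : realType) (P1 P2 : probability T R) (X : T -> R) :
  measurable_fun setT X -> (forall x, 0 <= X x) ->
  (forall t, 0 <= t ->
    (P2 [set x | (t < X x)%R] <= P1 [set x | (t < X x)%R])%E) ->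
  (\int[P2]_x (X x)%:E <= \int[P1]_x (X x)%:E)%E.
Proof.
move=> mX X0 tail; pose mX' := isMeasurableFun.Build _ _ _ _ X mX.
pose X' : {mfun T >-> R} := HB.pack X mX'.
have tailE (P : probability T R) t : ccdf (P := P) X' t = P [set x | t < X x].
  by rewrite /ccdf /= /pushforward set_itvoy.
have := @ge0_expectation_ccdf _ _ _ P1 X' X0.
have := @ge0_expectation_ccdf _ _ _ P2 X' X0.
rewrite !unlock => -> ->; apply: ge0_le_integral => //.
- exact: (measurable_funS _ _ (@ccdf_measurable _ _ _ _ X')).
- exact: (measurable_funS _ _ (@ccdf_measurable _ _ _ _ X')).
- by move=> t; rewrite /= in_itv /= andbT !tailE; exact: tail.
Qed.

Section unit_interval.
Context {R : realType}.
Local Notation B := (borel_unit_itv R).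
Local Notation val := (@unit_itv_val R).

Lemma unit_itv_val_itv (u : unit_itv R) : val u \in `]0, 1[.
Proof. exact: valP. Qed.

Lemma unit_itv_val_lt1 (u : unit_itv R) : val u < 1.
Proof. by have := unit_itv_val_itv u; rewrite in_itv => /andP[]. Qed.

(** [V] is the trace of its downward closure in [R], which is order-convex and hence Borel. *)
Lemma measurable_down_set (V : set B) :
  (forall u v, val u <= val v -> V v -> V u) -> measurable V.
Proof.
move=> dV; exists [set x | exists2 v, V v & x <= val v].
  apply: is_interval_measurable => x y [v Vv xv] [w Vw yw] z /andP[xz zy].
  by exists w => //; exact: le_trans yw.
rewrite setTI; apply/seteqP; split => u /= => [[v Vv uv]|Vu].
  exact: dV uv Vv.
by exists u.
Qed.

Lemma nondecreasing_measurable_unit_itv (f : B -> R) :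
  (forall u v, val u <= val v -> f u <= f v) -> measurable_fun setT f.
Proof.
move=> ndf; apply: (measurability _ (RGenInftyO.measurableE R)) => //.
move=> _ [_ [x ->] <-]; rewrite setTI.
apply: measurable_down_set => u v /ndf fuv /=; rewrite !in_itv /=.
exact: le_lt_trans.
Qed.

(** If [V] attains its supremum it is a ray, where [D1] and [D2] give the measures; otherwise it is
    an increasing union of rays and continuity from below applies. As [delta] lies in [V], the rays
    can be chosen to end at or after it. *)
Lemma le_down_set {D1 D2 : R -> R} {Q1 Q2 : probability B R} (delta : B)
    (V : set B) :
  corresponds_to Q1 D1 -> corresponds_to Q2 D2 ->
  (forall u, u \in `[val delta, 1[ -> D1 u <= D2 u) ->
  (forall u v, val u <= val v -> V v -> V u) -> V delta ->
  (Q1 V <= Q2 V)%E.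
Proof.
move=> Q1D Q2D D12 dV Vdelta.
have le_ray s : val delta <= s -> s < 1 ->
    (Q1 [set v | (val v <= s)%R] <= Q2 [set v | (val v <= s)%R])%E.
  move=> ds s1; have s01 : s \in `]0, 1[.
    move: (unit_itv_val_itv delta); rewrite !in_itv /= s1 andbT => /andP[d0 _].
    exact: lt_le_trans ds.
  by rewrite Q1D// Q2D// lee_fin D12// in_itv /= ds s1.
set s := sup (val @` V).
have supV : has_sup (val @` V).
  split; first by exists (val delta), delta.
  by exists 1 => _ [v _ <-]; exact/ltW/unit_itv_val_lt1.
have le_s v : V v -> val v <= s.
  by move=> Vv; apply: sup_upper_bound => //; exists v.
have [[m Vm ms]|nVs] := pselect ((val @` V) s).
  have -> : V = [set v | val v <= val m].
    apply/seteqP; split => v /=; first by rewrite ms; exact: le_s.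
    by move/dV; exact.
  apply: le_ray; first by rewrite ms; exact: le_s.
  exact: unit_itv_val_lt1.
(* The maximum keeps the endpoints in the range where [D1 <= D2]. They stay strictly below [s],
   hence below 1 even if [s = 1], as for [V] the whole interval. *)
pose a n := Num.max (val delta) (s - n.+1%:R^-1).
have [delta_s s1] : val delta < s /\ s <= 1.
  split.
    by rewrite lt_neqAle le_s// andbT; apply/eqP => E; apply: nVs; exists delta.
  by apply: ge_sup => [|_ [v _ <-]]; [case: supV|exact/ltW/unit_itv_val_lt1].
have as_ n : a n < s.
  by rewrite /a gt_max delta_s /= ltrBlDr ltrDl invr_gt0 ltr0n.
have VE : V = \bigcup_n [set v | val v <= a n].
  apply/seteqP; split => v /=.
    move=> Vv; have vs : 0 < s - val v.
      rewrite subr_gt0 lt_neqAle le_s// andbT; apply/eqP => E.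
      by apply: nVs; exists v.
    (* This index makes [n.+1%:R^-1] at most the gap [s - val v]. *)
    exists (Num.truncn (s - val v)^-1) => //=; rewrite /a le_max.
    apply/orP; right.
    rewrite lerBrDr -lerBrDl invf_ple ?posrE ?ltr0n// ltW//.
    exact: truncnS_gt.
  case=> n _ /= va; have : 0 < s - a n by rewrite subr_gt0.
  move=> /sup_adherent /(_ supV).
  move=> [_ [w Vw <-]]; rewrite opprB addrC subrK => aw.
  by apply: (dV _ w) => //; exact/(le_trans va)/ltW.
have mray t : measurable ([set v | val v <= t] : set B).
  by apply: measurable_down_set => u v uv /= /(le_trans uv).
have cvgV (Q : probability B R) :
    Q [set v | val v <= a n] @[n --> \oo] --> Q V.
  rewrite VE.
  apply: (@nondecreasing_cvg_mu _ B _ Q (fun n => [set v | val v <= a n])).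
  - by move=> n.
  - exact: bigcup_measurable.
  - move=> m n mn; apply/subsetPset => v /= /le_trans; apply.
    rewrite /a ge_max !le_max lexx /= lerD2l lerN2 lef_pV2 ?posrE ?ltr0n//.
    by rewrite ler_nat ltnS mn orbT.
apply: (lee_cvg_to (cvgV Q1) (cvgV Q2)); apply: nearW => n; apply: le_ray.
  by rewrite /a le_max lexx.
exact: lt_le_trans (as_ n) s1.
Qed.
End unit_interval.

(** Raising the level shrinks the set whose infimum is taken. As [inf] is a junk value on empty or
    unbounded-below sets, the limits 1 and 0 of the cdf must supply a point of the set at level [v]
    and a lower bound of the set at level [u]. *)
Lemma quantile_nondecreasing (d : measure_display) (T : measurableType d)
    (R : realType) (P : probability T R) (X : {RV P >-> R}) :
  {in `]0, 1[ &, {homo quantile X : u v / u <= v}}.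
Proof.
move=> u v; rewrite !in_itv /= => /andP[u0 _] /andP[_ v1] uv.
have [x vx] : exists x, (v%:E <= cdf X x)%E.
  apply/not_existsP => cdf_lt_v; suff : (1 <= v%:E)%E.
    by rewrite lee_fin leNgt v1.
  apply: (cvge_to_le (@cvg_cdfy1 _ _ _ _ X)); apply: nearW => y.
  by rewrite leNgt; apply/negP => /ltW; exact: cdf_lt_v.
have [y yu] : exists y, (cdf X y < u%:E)%E.
  apply/not_existsP => u_le_cdf; suff : (u%:E <= 0)%E.
    by rewrite lee_fin leNgt u0.
  apply: (cvge_to_ge (@cvg_cdfNy0 _ _ _ _ X)); apply: nearW => y.
  by rewrite leNgt; apply/negP; exact: u_le_cdf.
apply: lb_le_inf => [|z /= vz]; first by exists x.
have uz : (u%:E <= cdf X z)%E by apply: le_trans vz; rewrite lee_fin.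
apply: ge_inf => //; exists y => w /= uw; rewrite leNgt; apply/negP => wy.
have := lt_le_trans yu uw; rewrite ltNge => /negP; apply.
exact/cdf_nondecreasing/ltW.
Qed.

Theorem corollary3p6 (d : measure_display) (T : measurableType d)
    (R : realType) (P : probability T R)
    (D1 D2 : R -> R) (Q1 Q2 : probability (borel_unit_itv R) R)
    (hD1 : is_distortion D1) (hD2 : is_distortion D2)
    (hQ1 : corresponds_to Q1 D1) (hQ2 : corresponds_to Q2 D2)
    (hle : exists2 delta : R, delta \in `]0, 1[ &
             forall u : R, u \in `[delta, 1[ -> D1 u <= D2 u) :
  L_ P Q1 `<=` L_ P Q2.
Proof.
move=> X; rewrite /L_ /=; case: hle => delta delta01 D12 X_Q1.
pose delta' : borel_unit_itv R := exist _ delta delta01.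
pose f (u : borel_unit_itv R) := Num.max (quantile X (unit_itv_val u)) 0.
(* The tails of [f] at levels below [M] involve points before [delta], where [D1] and [D2] are not
   compared; subtracting [M] and truncating removes these levels. *)
pose M := f delta'; pose g u := Num.max (f u - M) 0.
have f0 u : 0 <= f u by rewrite /f le_max lexx orbT.
have g0 u : 0 <= g u by rewrite /g le_max lexx orbT.
have ndf u v : unit_itv_val u <= unit_itv_val v -> f u <= f v.
  move=> uv; rewrite /f ge_max !le_max lexx orbT andbT.
  by rewrite quantile_nondecreasing// unit_itv_val_itv.
have ndg u v : unit_itv_val u <= unit_itv_val v -> g u <= g v.
  by move=> /ndf fuv; rewrite /g ge_max !le_max lexx orbT andbT lerD2r fuv.
have mf := nondecreasing_measurable_unit_itv _ ndf.
have mg := nondecreasing_measurable_unit_itv _ ndg.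
have mEf : measurable_fun setT (EFin \o f) by exact/measurable_EFinP.
have mEg : measurable_fun setT (EFin \o g) by exact/measurable_EFinP.
have mEgM : measurable_fun setT (EFin \o (fun u => g u + M)).
  by apply/measurable_EFinP; apply: measurable_funD.
have gf u : g u <= f u by rewrite /g ge_max f0 andbT gerBl f0.
have fg u : f u <= g u + M by rewrite -lerBlDr /g le_max lexx.
have g_Q12 : (\int[Q2]_u (g u)%:E <= \int[Q1]_u (g u)%:E)%E.
  apply: ge0_le_integral_tail => // t t0.
  (* Both measures have mass 1, so passing to complements reverses the inequality between them. *)
  have downE : [set u | (t < g u)%R] = ~` [set u | (g u <= t)%R].
    by apply/seteqP; split => u /=; rewrite ltNge => /negP.
  have mdown : measurable [set u | (g u <= t)%R].
    by apply: measurable_down_set => u v /ndg /le_trans; exact.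
  rewrite downE !probability_setC//; apply: leeB => //.
  apply: (le_down_set delta' _ hQ1 hQ2) => //.
    by move=> u v /ndg /le_trans; exact.
  by rewrite /= /g subrr maxxx.
(* The constant [M] costs only the finite amount [M], since [Q2] has mass 1; what remains is the
   integral of [g], moved to [Q1] and bounded there by that of [f]. *)
apply: (@le_lt_trans _ _ (\int[Q2]_u (g u + M)%:E)%E).
  apply: ge0_le_integral => //.
  - by move=> u _; rewrite lee_fin; exact: f0.
  - by move=> u _; rewrite lee_fin; exact: fg.
under eq_integral do rewrite EFinD.
rewrite ge0_integralD//; [|by move=> u _; rewrite lee_fin; exact: g0|
  by move=> u _; rewrite lee_fin; exact: f0].
rewrite integral_cst// [X in (_ * X)%E](@probability_setT _ _ _ Q2).
rewrite mule1 lte_add_pinfty ?ltry//.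
apply: (le_lt_trans g_Q12); apply: le_lt_trans X_Q1.
by apply: ge0_le_integral => // u _; rewrite lee_fin; [exact: g0|exact: gf].
Qed.
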